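(* Let $p$ be a prime with $p\equiv 1\pmod 4$ and let $s$ be a positive integer. If $\bar a_s(6p)\equiv 0\pmod 2$, then for all integers $n,k\ge 0$ with $p\nmid(4n+3)$, $$\bar a_s\left(8p^{4k+1}n+6p^{4k+1}\right)\equiv 0\pmod{16}.$$
   Context: For integers $\ell\ge1$ write $f_\ell=\prod_{j\ge 1}(1-q^{\ell j})$. For a positive integer $s$, $\bar a_s(n)$ denotes the number of partitions of $n$ in which each odd part occurs in one of $s$ colors and the first occurrence of each part (parts of the same size but different colors being distinct) may be overlined. Equivalently, $$\sum_{n\ge0}\bar a_s(n)q^n=\frac{f_2^{3s-2}}{f_1^{2s}f_4^{s-1}}.$$ *)

(* Defs.v *)
From mathcomp Require Import all_boot.

Set Implicit Arguments.
Unset Strict Implicit.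
Unset Printing Implicit Defensive.

(* A pair (j, c) stands for a part of size j and colour c. In a partition of n
   no part exceeds n, so sizes are taken in 'I_n.+1. *)
Notation cpart s n := ('I_n.+1 * 'I_s)%type.

(* Only odd sizes come in s colours: a part of even size has the single
   colour 0. *)
Definition admissible (s n : nat) (x : cpart s n) : bool :=
  (0 < x.1) && (odd x.1 || (x.2 == 0 :> nat)).

(* A partition is given by the multiplicity m x of each coloured part x.
   Since only the first occurrence of x may be overlined, the overlining is a
   yes/no choice for each x that occurs: it is the set o of those x whose
   first occurrence is overlined. *)
Definition is_overpartition (s n : nat)
    (m : {ffun cpart s n -> 'I_n.+1}) (o : {set cpart s n}) : bool :=
  [&& [forall x : cpart s n, (0 < m x) ==> admissible x],
      [forall x in o, 0 < m x]
    & \sum_(x : cpart s n) x.1 * m x == n].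

Definition abar (s n : nat) : nat :=
  #|[set mo : {ffun cpart s n -> 'I_n.+1} * {set cpart s n}
      | is_overpartition mo.1 mo.2]|.

(* Main.v *)
Require Import Defs.
From mathcomp Require Import all_boot all_algebra ring zify.

Set Implicit Arguments.
Unset Strict Implicit.
Unset Printing Implicit Defensive.

Import GRing.Theory.

(** With phi(-q) = 1 + 2S and phi(-q^2) = 1 + 2T, where S is the sum over i >= 1
    of (-1)^i q^(i^2) and T = S(q^2), Gauss's product for phi turns the generating
    function into phi(-q^2)^(s-1) / phi(-q)^s.  Modulo 16 the eighth power of
    phi(-q) is 1, so this is (1 + 2T)^(s-1) (1 + 2S)^(7s), and only products of at
    most three factors S, T survive.  Squaring is additive under the coefficient 8,
    so 8 S^2 = 8 T and 8 T^2 = 8 U with U = S(q^4).  At N = 2M with M = 3 mod 4 all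
    terms vanish because 2M and M are neither squares nor sums of two squares,
    except for multiples of 8 [ST]_N and 8 [TU]_N, which both count the
    representations M = x^2 + 2y^2 with x, y > 0.  (The term 4(s-1)(7s) ST is such
    a multiple since s(s-1) is even.)

    That count is even.  For M = 7 mod 8 it is 0.  For M = 3 mod 8, Jackson's
    windmill involution on the solutions of M = x^2 + 2yz shows that it has the
    parity of the number of divisors of M below sqrt M; and this number is even
    when some prime has odd exponent v in M = p^v m and m is not a square. *)

(** * Parity of the number of representations by x^2 + 2y^2 *)

Lemma odd_size_involution (T : eqType) (f : T -> T) (s : seq T) :
  uniq s -> {in s, forall x, (f x \in s) && (f (f x) == x)} ->
  odd (size s) = odd (count (fun x => f x == x) s).
Proof.
have [n] := ubnP (size s); elim: n s => // n IHn [|x s] //= /ltnSE lt_sn.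
case/andP=> xNs uniq_s f_s.
have /andP[fx_s /eqP ffx] := f_s x (mem_head x s).
have [fx | fxNx] /= := eqVneq (f x) x.
  rewrite oddD /=; congr (~~ _); apply: IHn => // y y_s.
  have /andP[fy_s ->] := f_s y (mem_behead (s := x :: s) y_s); rewrite andbT.
  move: fy_s; rewrite inE => /predU1P[fy|//].
  have /andP[_ /eqP ffy] := f_s y (mem_behead (s := x :: s) y_s).
  by move: xNs; rewrite -fx -{1}fy ffy y_s.
have {}fx_s : f x \in s by move: fx_s; rewrite inE (negPf fxNx).
have perm_s := perm_to_rem fx_s.
rewrite (perm_size perm_s) (permP perm_s) /= ffx eq_sym (negPf fxNx) !add0n negbK.
have := rem_uniq (f x) uniq_s => uniq_r.
have size_r : size (rem (f x) s) < n.
  by apply: leq_trans lt_sn; rewrite (perm_size perm_s) /=.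
apply: IHn => // y; rewrite mem_rem_uniq // !inE => /andP[yNfx y_s].
have /andP[fy_s /eqP ffy] := f_s y (mem_behead (s := x :: s) y_s).
rewrite ffy eqxx andbT mem_rem_uniq // !inE.
move: fy_s; rewrite inE => /predU1P[fy|->].
  by move: yNfx; rewrite -fy ffy eqxx.
rewrite andbT; apply: contraNneq xNs => eq_f.
by rewrite -ffx -eq_f ffy.
Qed.

Lemma sqr_mod8 u :
  [|| (u * u) %% 8 == 0, (u * u) %% 8 == 1 | (u * u) %% 8 == 4].
Proof.
rewrite -modnMm; have: u %% 8 < 8 by rewrite ltn_mod.
by case: (u %% 8) => [|[|[|[|[|[|[|[|]]]]]]]].
Qed.

(** * Jackson's windmill involution *)

Section Windmill.

Variable M : nat.

Definition windmill (t : nat * nat * nat) : bool :=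
  let: (x, y, z) := t in
  [&& 0 < x, 0 < y, 0 < z & x ^ 2 + 2 * (y * z) == M].

(* The windmill map of T. Jackson's proof that primes p = 3 mod 8 are of the form
   x^2 + 2y^2.  A fixed point of the third branch would make M a sum of two
   squares, one of the fourth branch would make M of the form u^2 - 2z^2. *)
Definition jackson (t : nat * nat * nat) : nat * nat * nat :=
  let: (x, y, z) := t in
  if 2 * y < x then (x - 2 * y, z + 2 * x - 2 * y, y)
  else if 2 * y < 2 * x + z then (2 * y - x, y, 2 * x + z - 2 * y)
  else if 2 * y < 3 * x + 2 * z then
    (3 * x + 2 * z - 2 * y, 2 * x + 2 * z - y, 2 * y - 2 * x - z)
  else if y < 2 * x + 2 * z then
    (2 * y - 3 * x - 2 * z, 2 * y - 2 * x - z, 2 * x + 2 * z - y)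
  else (x + 2 * z, z, y - 2 * x - 2 * z).

Hypothesis M_mod8 : M %% 8 = 3.

Lemma windmill_odd t : windmill t -> odd t.1.1.
Proof.
case: t => [[x y] z] /= /and4P[_ _ _ /eqP eM].
have : odd M by lia.
by rewrite -eM oddD oddX oddM addbF.
Qed.

(** The first and fifth branches are inverse to each other; each of the other three is its own
    inverse. On a boundary between branches the map would produce a zero coordinate, so boundaries
    must be excluded. *)
Lemma jackson_windmill t : windmill t ->
  windmill (jackson t) && (jackson (jackson t) == t).
Proof.
move=> wt; have := windmill_odd wt.
case: t wt => [[x y] z] /= /and4P[x0 y0 z0 /eqP eM] x_odd.
have sq u : u * u <> M by have := sqr_mod8 u; lia.
(* Equality in [neq1] or [neq3] contradicts odd x; equality in [neq2] or [neq4] makes M the square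
   of x + z or x + 2z. *)
have neq1 : 2 * y <> x by lia.
have neq2 : 2 * y <> 2 * x + z.
  move=> e; case: (leqP x (2 * y)) => [le_xy|]; last by lia.
  apply: (sq (2 * y - x)); have -> : 2 * y - x = x + z by lia.
  nia.
have neq3 : 2 * y <> 3 * x + 2 * z by lia.
have neq4 : y <> 2 * x + 2 * z.
  by move=> e; apply: (sq (x + 2 * z)); rewrite -eM e; lia.
have norm1 u v w : x = u + 2 * y -> v = z + 2 * u + 2 * y -> w = y ->
    u ^ 2 + 2 * (v * w) = M by rewrite -eM => -> -> ->; lia.
have norm2 u w : x + u = 2 * y -> w + 2 * y = 2 * x + z ->
    u ^ 2 + 2 * (y * w) = M by rewrite -eM; nia.
have norm3 u v w : u + 2 * y = 3 * x + 2 * z -> v + y = 2 * x + 2 * z ->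
  w + 2 * x + z = 2 * y -> u ^ 2 + 2 * (v * w) = M by rewrite -eM; nia.
have norm4 u v w : u + 3 * x + 2 * z = 2 * y -> w + y = 2 * x + 2 * z ->
  v + 2 * x + z = 2 * y -> u ^ 2 + 2 * (v * w) = M by rewrite -eM; nia.
have norm5 w : y = w + 2 * x + 2 * z ->
    (x + 2 * z) ^ 2 + 2 * (z * w) = M by rewrite -eM => ->; lia.
have jackson_inv : jackson (jackson (x, y, z)) == (x, y, z).
  rewrite [jackson (x, y, z)]/jackson.
  by do 4?[case: ifP => ?]; rewrite /jackson; do 4?[case: ifP => ?];
    rewrite !xpair_eqE; lia.
move: jackson_inv; rewrite [jackson (x, y, z)]/jackson.
case: ifP => c1; [|case: ifP => c2; [|case: ifP => c3; [|case: ifP => c4]]] => ->;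
  rewrite andbT; apply/and4P; (split; [lia..|apply/eqP]).
- by apply: norm1; lia.
- by apply: norm2; lia.
- by apply: norm3; lia.
- by apply: norm4; lia.
- by apply: norm5; lia.
Qed.

(** A triple with x = y falls in the second branch, which fixes exactly such triples; the first and
    fifth branches change x. *)
Lemma jackson_fixed t : windmill t -> (jackson t == t) = (t.1.1 == t.1.2).
Proof.
move=> wt; have := windmill_odd wt.
case: t wt => [[x y] z] /= /and4P[x0 y0 z0 /eqP eM] x_odd.
case: ifP => c1; [|case: ifP => c2; [|case: ifP => c3; [|case: ifP => c4]]];
  rewrite !xpair_eqE; try lia.
- have [e|] := eqVneq y (x + z); last by lia.
  have : (x + z) * (x + z) + z * z = M by rewrite -eM e; lia.
  by have := sqr_mod8 (x + z); have := sqr_mod8 z; lia.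
- have [e|] := eqVneq y (2 * x + z); last by lia.
  have : (x + 2 * z) * (x + 2 * z) = M + 2 * (z * z) by rewrite -eM e; lia.
  by have := sqr_mod8 (x + 2 * z); have := sqr_mod8 z; lia.
Qed.

End Windmill.

Lemma size_bij (T U : eqType) (f : T -> U) (s : seq T) (t : seq U) :
  uniq s -> uniq t -> {in s &, injective f} ->
  (forall y, (y \in t) = (y \in map f s)) -> size s = size t.
Proof.
move=> us ut f_inj eq_mem; rewrite -(size_map f); apply/perm_size/uniq_perm => //.
by rewrite map_inj_in_uniq.
Qed.

Lemma sqr_lt_cofactor (a b M : nat) : a * b = M -> 0 < M -> (a ^ 2 < M) = (a < b).
Proof.
move=> <-; rewrite muln_gt0 => /andP[a_gt0 _].
by rewrite -mulnn ltn_pmul2l.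
Qed.

Definition below_sqrt (M : nat) : seq nat := [seq d <- divisors M | d * d < M].

(** * Parity of the number of divisors of p^v m below the square root *)

Section SmallDivisors.

Variables p v m : nat.
Hypotheses (p_pr : prime p) (v_odd : odd v) (pNm : ~~ (p %| m)).
Hypothesis m_not_sqr : forall u, u * u <> m.

Let M := p ^ v * m.

(** The pair (i, e) encodes the divisor p^i e of M, uniquely since p does not divide m. *)
Let small := [seq t <- [seq (i, e) | i <- iota 0 v.+1, e <- divisors m]
             | (p ^ t.1 * t.2) ^ 2 < M].

Let m_gt0 : 0 < m. Proof. by case: m pNm => //; rewrite dvdn0. Qed.

Let mem_small i e :
  ((i, e) \in small) = [&& i <= v, e %| m & (p ^ i * e) ^ 2 < M].
Proof.
rewrite mem_filter andbC andbA; congr (_ && _).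
apply/allpairsPdep/andP => [[j [f [jP fP [-> ->]]]]|[iP eP]].
  by rewrite mem_iota in jP; rewrite -dvdn_divisors in fP.
by exists i, e; rewrite mem_iota -dvdn_divisors.
Qed.

Let small_uniq : uniq small.
Proof.
apply: filter_uniq; apply: allpairs_uniq; rewrite ?iota_uniq ?divisors_uniq //.
by case=> [? ?] [? ?] _ _ [-> ->].
Qed.

(* The second alternative is the cofactor of p^(v - i) e in M, so that exactly one
   of the two candidates lies below sqrt M. *)
Let flip (t : nat * nat) : nat * nat :=
  if (p ^ (v - t.1) * t.2) ^ 2 < M then (v - t.1, t.2) else (t.1, m %/ t.2).

Let compl i e : i <= v -> e %| m -> p ^ i * (m %/ e) * (p ^ (v - i) * e) = M.
Proof.
move=> iv em; rewrite mulnACA -expnD subnKC // mulnC divnK //.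
by rewrite mulnC.
Qed.

Let M_gt0 : 0 < M. Proof. by rewrite muln_gt0 expn_gt0 prime_gt0. Qed.

Let logn_pM k e : e %| m -> logn p (p ^ k * e) = k.
Proof.
move=> em; have e_gt0 := dvdn_gt0 m_gt0 em.
rewrite lognM ?e_gt0 ?expn_gt0 ?prime_gt0 // pfactorK // [logn p e]lognE.
by rewrite (contraNF (fun h => dvdn_trans h em) pNm) !andbF addn0.
Qed.

(** The exponent of p in M is v, which is odd. *)
Let M_not_sqr u : u ^ 2 <> M.
Proof.
move=> /(congr1 (logn p)); rewrite lognX logn_pM // => ev.
by move: v_odd; rewrite -ev oddM.
Qed.

Let flip_small : {in small, forall t, (flip t \in small) && (flip (flip t) == t)}.
Proof.
case=> i e; rewrite mem_small => /and3P[iv em lt_M]; rewrite /flip /=.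
have e_gt0 := dvdn_gt0 m_gt0 em.
case: ifP => [lt2 | ge2] /=.
  by rewrite mem_small leq_subr em lt2 subKn //= lt_M eqxx.
(* Here b is not below sqrt M, so its cofactor a is, equality being excluded because M is not a
   square. *)
have := compl iv em; set a := p ^ i * _; set b := p ^ (v - i) * e => abM.
have ltM2 : a ^ 2 < M.
  move: ge2; rewrite (sqr_lt_cofactor (a := b) (b := a)) 1?mulnC //.
  move/negbT; rewrite -leqNgt (sqr_lt_cofactor abM) // ltn_neqAle => ->.
  by rewrite andbT; apply/eqP => eq_ab; apply: (@M_not_sqr a); rewrite -mulnn {2}eq_ab.
have mem : m %/ e %| m by apply: dvdn_div.
have := compl iv mem; rewrite divnA // mulKn //.
set c := p ^ i * e; set d := p ^ (v - i) * (m %/ e) => cdM.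
(* The second flip tests d, the cofactor of c. Since c is below sqrt M, d is not, and the second
   alternative is taken again. *)
have -> : d ^ 2 < M = false.
  move: lt_M; rewrite (sqr_lt_cofactor cdM) // => lt_cd.
  by rewrite (sqr_lt_cofactor (a := d) (b := c)) 1?mulnC // ltnNge ltnW.
by rewrite mem_small iv mem eqxx ltM2.
Qed.

(** A fixed point would give v = 2i or m = e^2. *)
Let flip_neq : {in small, forall t, flip t == t = false}.
Proof.
case=> i e; rewrite mem_small => /and3P[iv em lt_M]; rewrite /flip /=.
case: ifP => _; rewrite xpair_eqE ?eqxx ?andbT /=; apply/negP => /eqP eq_t.
  by move: v_odd; rewrite -(subnK iv) eq_t oddD addbb.
by apply: (@m_not_sqr e); rewrite -{1}eq_t divnK.
Qed.

Let size_small : size small = size (below_sqrt M).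
Proof.
apply: (@size_bij _ _ (fun t => p ^ t.1 * t.2)) => //.
- by rewrite filter_uniq ?divisors_uniq.
- case=> [i e] [j f]; rewrite !mem_small /=.
  move=> /and3P[_ em _] /and3P[_ fm _] eq_t.
  have eij : i = j by rewrite -(logn_pM i em) eq_t logn_pM.
  move: eq_t; rewrite eij => /eqP; rewrite eqn_pmul2l ?expn_gt0 ?prime_gt0 //.
  by move/eqP->.
- move=> d; rewrite mem_filter -dvdn_divisors //; apply/andP/mapP.
    case=> lt_d dM; have d_gt0 := dvdn_gt0 M_gt0 dM.
    have [e ep ed] := pfactor_coprime p_pr d_gt0.
    exists (logn p d, e); last by rewrite mulnC.
    rewrite mem_small -[_ * e]mulnC -ed -mulnn lt_d andbT; apply/andP; split.
      by have := dvdn_leq_log p M_gt0 dM; rewrite logn_pM.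
    rewrite -(@Gauss_dvdr _ (p ^ v)) ?coprimeXr 1?coprime_sym //.
    by apply: dvdn_trans dM; rewrite ed dvdn_mulr.
  case=> -[i e]; rewrite mem_small => /and3P[iv em lt_M] ->.
  by rewrite mulnn lt_M dvdn_mul // dvdn_exp2l.
Qed.

Lemma even_below_sqrt : ~~ odd (size (below_sqrt M)).
Proof.
rewrite -size_small (odd_size_involution small_uniq flip_small).
by rewrite (eq_in_count (a2 := pred0)) ?count_pred0.
Qed.

End SmallDivisors.

(* Positive x, y <= B; these are all positive solutions once M <= B. *)
Definition reps12 (B M : nat) : seq (nat * nat) :=
  [seq t <- [seq (x, y) | x <- iota 1 B, y <- iota 1 B] | t.1 ^ 2 + 2 * t.2 ^ 2 == M].

Lemma mem_reps12 B M x y : M <= B ->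
  ((x, y) \in reps12 B M) = [&& 0 < x, 0 < y & x ^ 2 + 2 * y ^ 2 == M].
Proof.
move=> MB; rewrite mem_filter /= andbC andbA.
have [e|] := eqVneq; last by rewrite !andbF.
rewrite !andbT; apply/allpairsPdep/andP => [[a [b [aP bP [-> ->]]]]|[x0 y0]].
  by rewrite !mem_iota in aP bP; lia.
by exists x, y; rewrite !mem_iota; split=> //; nia.
Qed.

Lemma reps12_uniq B M : uniq (reps12 B M).
Proof.
apply: filter_uniq; apply: allpairs_uniq; rewrite ?iota_uniq //.
by case=> [? ?] [? ?] _ _ [-> ->].
Qed.

Definition windmills (M : nat) : seq (nat * nat * nat) :=
  [seq t <- [seq (u, z) | u <- [seq (x, y) | x <- iota 0 M.+1, y <- iota 0 M.+1],
                           z <- iota 0 M.+1] | windmill M t].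

Lemma mem_windmills M t : (t \in windmills M) = windmill M t.
Proof.
rewrite mem_filter; apply: andb_idr; case: t => [[x y] z].
rewrite /windmill => /and4P[x0 y0 z0 /eqP e].
have [? ? ?] : [/\ x < M.+1, y < M.+1 & z < M.+1] by split; nia.
apply/allpairsPdep; exists (x, y), z; rewrite mem_iota; split=> //.
by apply/allpairsPdep; exists x, y; rewrite !mem_iota.
Qed.

Lemma windmills_uniq M : uniq (windmills M).
Proof.
apply: filter_uniq; apply: allpairs_uniq; rewrite ?iota_uniq //.
  apply: allpairs_uniq; rewrite ?iota_uniq //.
  by case=> [? ?] [? ?] _ _ [-> ->].
by case=> [? ?] [? ?] _ _ [-> ->].
Qed.

(** Two involutions act on the solutions of x^2 + 2yz = M. Swapping y and z fixes the
    representations x^2 + 2y^2; the fixed points of [jackson] have x = y, so M = x(x + 2z) and x is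
    a divisor below sqrt M. *)
Lemma odd_reps12 B M : M %% 8 = 3 -> M <= B ->
  odd (size (reps12 B M)) = odd (size (below_sqrt M)).
Proof.
move=> M8 MB; transitivity (odd (size (windmills M))).
  pose sw (t : nat * nat * nat) := (t.1.1, t.2, t.1.2).
  rewrite (odd_size_involution (f := sw) (windmills_uniq M)); last first.
    case=> [[x y] z]; rewrite !mem_windmills /= eqxx andbT.
    by case/and4P=> -> -> -> /eqP<- /=; rewrite mulnC [z * y]mulnC mulnC.
  rewrite -size_filter; congr (odd _).
  apply: (@size_bij _ _ (fun t => (t.1, t.2, t.2))).
  - exact: reps12_uniq.
  - by rewrite filter_uniq ?windmills_uniq.
  - by case=> [? ?] [? ?] _ _ [-> ->].
  case=> [[x y] z]; rewrite mem_filter mem_windmills /= xpair_eqE xpair_eqE eqxx /=.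
  apply/andP/mapP => [[/andP[/eqP -> _] /and4P[x0 y0 _ e]]|].
    by exists (x, y) => //; rewrite mem_reps12 // x0 y0 -mulnn.
  by case=> -[a b]; rewrite mem_reps12 // => /and3P[a0 b0 e] [-> -> ->] /=;
    rewrite a0 b0 mulnn e eqxx.
rewrite (odd_size_involution (f := jackson) (windmills_uniq M)); last first.
  by move=> t; rewrite !mem_windmills; apply: jackson_windmill.
rewrite -size_filter; congr (odd _).
apply: (@size_bij _ _ (fun t => t.1.1)).
- by rewrite filter_uniq ?windmills_uniq.
- by rewrite filter_uniq ?divisors_uniq.
- case=> [[x y] z] [[x' y'] z'].
  rewrite mem_filter mem_windmills mem_filter mem_windmills.
  move=> /andP[jt wt] /andP[jt' wt'] /= ex; subst x'.
  move: jt jt'; rewrite !(jackson_fixed M8) //= => /eqP ey /eqP ey'; subst y y'.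
  move: wt wt' => /= /and4P[? ? ? /eqP e] /and4P[_ _ ? /eqP e'].
  by congr (_, _, _); nia.
have M0 : 0 < M by lia.
move=> d; rewrite mem_filter -dvdn_divisors //; apply/andP/mapP.
  case=> lt_d /dvdnP[k ek]; have kd : d < k by nia.
  have ok : odd k /\ odd d by apply/andP; rewrite -oddM -ek; lia.
  (* The cofactors d < k of M are both odd, so z = (k - d)/2 is an integer and M = d(d + 2z). *)
  exists (d, d, (k - d)./2) => //; have ez : k = d + (k - d)./2 * 2 by lia.
  have wt : windmill M (d, d, (k - d)./2).
    by apply/and4P; split; [lia..|apply/eqP; move: ez ek; nia].
  by rewrite mem_filter mem_windmills wt (jackson_fixed M8) //= eqxx.
case=> -[[x y] z]; rewrite mem_filter mem_windmills => /andP[jt wt] /= ->.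
move: jt wt => /[swap] wt; rewrite (jackson_fixed M8 wt) /= => /eqP exy.
move: wt; rewrite /windmill -exy => /and4P[x0 _ z0 /eqP e].
by split; [nia|apply/dvdnP; exists (x + 2 * z); lia].
Qed.

(** * Gauss's product for theta, modulo q^K *)

Section QBinomial.

Local Open Scope ring_scope.

Variables (R : comNzRingType) (x : R).

(** Gaussian binomial coefficients by a Pascal rule, which avoids division in R. *)
Fixpoint qbin (m k : nat) : R :=
  match m, k with
  | _, 0 => 1
  | 0, _.+1 => 0
  | m'.+1, k'.+1 => qbin m' k + x ^+ (m' - k') * qbin m' k'
  end.

Definition qfact (m : nat) : R := \prod_(1 <= i < m.+1) (1 - x ^+ i).

Lemma qbin0 m : qbin m 0 = 1. Proof. by case: m. Qed.

Lemma qbin_small m k : (m < k)%N -> qbin m k = 0.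
Proof.
elim: m k => [|m IHm] [|k] //= lt_mk.
by rewrite !IHm ?mulr0 ?addr0 // ltnW.
Qed.

Lemma qfactS m : qfact m.+1 = qfact m * (1 - x ^+ m.+1).
Proof. by rewrite /qfact big_nat_recr. Qed.

(** The Pascal rule reduces this to x^(m-k) (1 - x^(k+1)) + (1 - x^(m-k)) = 1 - x^(m+1). The case k
    = m is apart, as there the first Pascal term vanishes. *)
Lemma qbin_qfact m k : (k <= m)%N ->
  qbin m k * qfact k * qfact (m - k) = qfact m.
Proof.
have qfact0 : qfact 0 = 1 by rewrite /qfact big_geq.
elim: m k => [|m IHm] [|k] // le_km; rewrite ?qbin0 ?qfact0 ?subn0 ?mulr1 ?mul1r //=.
rewrite subSS !mulrDl.
have -> : x ^+ (m - k) * qbin m k * qfact k.+1 * qfact (m - k) =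
          x ^+ (m - k) * (1 - x ^+ k.+1) * qfact m.
  by rewrite -(IHm k) // qfactS; ring.
have [lt_km | le_mk] := ltnP k m; last first.
  have -> : k = m by apply/eqP; rewrite eqn_leq le_mk andbT -ltnS.
  by rewrite qbin_small // subnn qfactS; ring.
have -> : (m - k = (m - k.+1).+1)%N by lia.
rewrite [qfact (m - k.+1).+1]qfactS mulrA IHm // qfactS.
have -> : x ^+ m.+1 = x ^+ (m - k.+1).+1 * x ^+ k.+1.
  by rewrite -exprD; congr (x ^+ _); lia.
ring.
Qed.

Lemma qbinomial m (y z : R) :
  \prod_(0 <= i < m) (y + z * x ^+ i) =
  \sum_(0 <= k < m.+1) x ^+ 'C(k, 2) * qbin m k * z ^+ k * y ^+ (m - k).
Proof.
elim: m => [|m IHm]; first by rewrite big_geq // big_nat1 /= !expr0 !mulr1.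
rewrite big_nat_recr //= IHm mulrDr.
rewrite [RHS]big_nat_recl // [in RHS](eq_big_nat _ _ (F2 := fun k =>
  x ^+ 'C(k.+1, 2) * qbin m k.+1 * z ^+ k.+1 * y ^+ (m - k) +
  x ^+ 'C(k, 2) * qbin m k * z ^+ k * y ^+ (m - k) * (z * x ^+ m))); last first.
  move=> k /andP[_ lt_km] /=; rewrite subSS binS bin1 exprD.
  have -> : x ^+ m = x ^+ k * x ^+ (m - k) by rewrite -exprD; congr (x ^+ _); lia.
  by rewrite exprS; ring.
rewrite big_split /= -big_distrl /= addrA; congr (_ + _).
rewrite [in RHS]big_nat_recr //= qbin_small // mulr0 !mul0r addr0.
rewrite big_nat_recl // mulrDl qbin0 subn0; congr (_ + _); first by rewrite exprS; ring.
rewrite big_distrl /=; apply: eq_big_nat => k lt_km.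
have -> : (m - k = (m - k.+1).+1)%N by lia.
by rewrite [y ^+ _.+1]exprS; ring.
Qed.

End QBinomial.

Lemma double_bin2 k : 'C(k, 2).*2 = k * k.-1.
Proof. by elim: k => // k; rewrite binS bin1 doubleD => ->; case: k => //= k; lia. Qed.

(** Completes the square in the exponents of [finite_gauss]: with c = n(n-1) + n(2n-1), the k-th
    term of the q-binomial sum has exponent c + (k-n)^2. *)
Lemma square_exponent n k : 0 < n -> k <= n.*2 ->
  'C(n, 2).*2 + n * n.*2.-1 + (k - n + (n - k)) ^ 2 =
  'C(k, 2).*2 + n.*2.-1 * (n.*2 - k).
Proof.
move=> n_gt0 le_k2n; rewrite !double_bin2; have [le_nk | /ltnW le_kn] := leqP n k.
  have [d [e [en ek]]] : exists d e, n = d + e /\ k = 2 * d + e.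
    by exists (k - n), (n.*2 - k); lia.
  have -> : n.*2 - k = e by lia.
  have -> : k - n + (n - k) = d by lia.
  rewrite en ek; case: d {en ek} => [|d]; first by case: e => //= e; lia.
  have -> : 2 * d.+1 + e = (2 * d + e).+2 by lia.
  have -> : d.+1 + e = (d + e).+1 by [].
  by rewrite doubleS !succnK; lia.
have [d en] : exists d, n = k + d by exists (n - k); lia.
have -> : k - n + (n - k) = d by lia.
have -> : n.*2 - k = k + d.*2 by lia.
rewrite en; case: k {le_k2n le_kn} en => [|k] en; first by case: d en => [|d]; lia.
have -> : k.+1 + d = (k + d).+1 by [].
by rewrite doubleS !succnK; lia.
Qed.

Section Gauss.

Local Open Scope ring_scope.

Lemma rmorph_qbin (R S : comNzRingType) (f : {rmorphism R -> S}) x m k :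
  f (qbin x m k) = qbin (f x) m k.
Proof.
elim: m k => [|m IHm] [|k] /=; rewrite ?rmorph1 ?rmorph0 //.
by rewrite rmorphD rmorphM rmorphXn !IHm.
Qed.

(* The q-binomial theorem at x = X^2, y = X^(2n-1), z = -1, divided by a power of X.
   The truncated differences in the exponent add up to |k - n|. *)
Lemma finite_gauss (R : comNzRingType) n :
  (\prod_(0 <= i < n) (1 - 'X^(i.*2.+1))) ^+ 2 =
  \sum_(0 <= k < n.*2.+1)
     (-1) ^+ (n + k) * 'X^((k - n + (n - k)) ^ 2) * qbin ('X^2) n.*2 k :> {poly R}.
Proof.
have [-> | n_gt0] := posnP n.
  by rewrite big_geq // double0 big_nat1 /= expr1n !mulr1.
pose c := ('C(n, 2).*2 + n * n.*2.-1)%N.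
have := qbinomial ('X^2 : {poly R}) n.*2 'X^(n.*2.-1) (-1).
have -> : \prod_(0 <= i < n.*2) ('X^(n.*2.-1) + -1 * 'X^2 ^+ i) =
  (-1) ^+ n * 'X^c * (\prod_(0 <= i < n) (1 - 'X^(i.*2.+1))) ^+ 2 :> {poly R}.
  (* For i < n the factor is -X^(2i) (1 - X^(2(n-i-1)+1)); for i = n + j it is X^(2n-1) (1 -
     X^(2j+1)). Each half yields one copy of P. *)
  rewrite (big_cat_nat (n := n)) //=; last by lia.
  set P := \prod_(0 <= i < n) (1 - _); rewrite /c exprD.
  transitivity (((-1) ^+ n * 'X^('C(n, 2).*2) * P) * ('X^(n * n.*2.-1) * P));
    last by ring.
  congr (_ * _).
    rewrite (eq_big_nat _ _ (F2 := fun i =>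
      -1 * 'X^i ^+ 2 * (1 - 'X^((n - i.+1).*2.+1)))).
      rewrite !big_split /= prodr_const_nat subn0; congr (_ * _ * _); last first.
        by rewrite /P [RHS]big_nat_rev /= add0n.
      by rewrite -expr_sum bin2_sum -exprD addnn.
    move=> i /andP[_ lt_in]; rewrite -!exprM.
    have -> : 'X^(n.*2.-1) = 'X^(i * 2) * 'X^((n - i.+1).*2.+1) :> {poly R}.
      by rewrite -exprD; congr ('X^_); lia.
    by rewrite [(2 * i)%N]mulnC; ring.
  rewrite -{1}[n]add0n -addnn big_addn addnK.
  rewrite (eq_big_nat _ _ (F2 := fun i => 'X^(n.*2.-1) * (1 - 'X^(i.*2.+1)))).
    by rewrite big_split /= prodr_const_nat subn0 -exprM mulnC addnn.
  move=> i _; rewrite addnn -!exprM mulrBr mulr1 -exprD mulN1r.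
  by congr (_ - 'X^_); lia.
have -> : \sum_(0 <= k < n.*2.+1)
    'X^2 ^+ 'C(k, 2) * qbin ('X^2) n.*2 k * (-1) ^+ k * 'X^(n.*2.-1) ^+ (n.*2 - k) =
  (-1) ^+ n * 'X^c * \sum_(0 <= k < n.*2.+1)
     (-1) ^+ (n + k) * 'X^((k - n + (n - k)) ^ 2) * qbin ('X^2) n.*2 k :> {poly R}.
  rewrite big_distrr /=; apply: eq_big_nat => k; rewrite ltnS => lt_k2n.
  rewrite -!exprM exprD.
  have -> : (-1) ^+ n * 'X^c * ((-1) ^+ n * (-1) ^+ k *
              'X^((k - n + (n - k)) ^ 2) * qbin 'X^2 n.*2 k) =
            (-1) ^+ n ^+ 2 * (-1) ^+ k *
            'X^(c + (k - n + (n - k)) ^ 2) * qbin 'X^2 n.*2 k :> {poly R}.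
    by rewrite exprD; ring.
  rewrite sqrr_sign mul1r.
  rewrite /c square_exponent // -['C(k, 2).*2]mul2n.
  by rewrite exprD; ring.
have reg : GRing.lreg ((-1) ^+ n * 'X^c : {poly R}).
  by apply: lregM; [apply: lreg_sign|apply: monic_lreg; rewrite monicXn].
by move/reg.
Qed.

(** * Infinite products and Gauss's identity at nilpotent q *)

Section Truncated.

Variables (A : comNzRingType) (K : nat).
Implicit Type q : A.

Lemma expr_trunc q (qK : q ^+ K = 0) i : (K <= i)%N -> q ^+ i = 0.
Proof. by move=> le_Ki; rewrite -(subnK le_Ki) exprD qK mulr0. Qed.

(** Iterating d = q^(i+1) d gives d = q^((i+1)K) d = 0. *)
Lemma lreg_1sub q i : q ^+ K = 0 -> GRing.lreg (1 - q ^+ i.+1).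
Proof.
move=> qK u v /eqP; rewrite -subr_eq0 -mulrBr mulrBl mul1r subr_eq0 => /eqP e.
apply/eqP; rewrite -subr_eq0; apply/eqP; move: e; set d := u - v => e.
have {}e j : d = q ^+ (i.+1 * j) * d.
  elim: j => [|j IHj]; first by rewrite muln0 mul1r.
  by rewrite mulnS exprD -mulrA -IHj.
by rewrite (e K) (expr_trunc qK) ?mul0r // mulSn leq_addr.
Qed.

Lemma prod_trunc (F : nat -> A) L : (forall i, (K <= i)%N -> F i = 1) -> (K <= L)%N ->
  \prod_(0 <= i < L) F i = \prod_(0 <= i < K) F i.
Proof.
move=> F1 le_KL; rewrite (big_cat_nat (n := K)) //= [X in _ * X]big_nat_cond.
rewrite [X in _ * X]big1 ?mulr1 // => i; rewrite andbT => /andP[le_Ki _]; exact: F1.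
Qed.

Definition odd_euler_prod q : A := \prod_(0 <= i < K) (1 - q ^+ i.*2.+1).
Definition euler_prod q : A := \prod_(0 <= i < K) (1 - q ^+ i.+1).
(* When q ^+ K = 0, theta K q is phi(-q). *)
Definition theta_half q : A := \sum_(1 <= i < K) (-1) ^+ i * q ^+ (i ^ 2).
Definition theta q : A := 1 + 2 * theta_half q.

Lemma euler_prod_lreg q : q ^+ K = 0 -> GRing.lreg (euler_prod q).
Proof.
by move=> qK; apply: big_ind => [||i _]; [exact: lreg1|exact: lregM|exact: lreg_1sub].
Qed.

Variable q : A.
Hypothesis qK : q ^+ K = 0.

(** Extending the product to 2K factors, the new ones being 1, leaves exactly K odd and K even
    exponents. *)
Lemma euler_prod_split : euler_prod q = odd_euler_prod q * euler_prod (q ^+ 2).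
Proof.
rewrite /euler_prod -(prod_trunc (L := K.*2)) -?addnn ?leq_addr //; last first.
  by move=> i le_Ki; rewrite (expr_trunc qK) ?subr0 // ltnW.
rewrite /odd_euler_prod -big_split /= addnn.
elim: K => [|k IHk]; first by rewrite !big_geq.
rewrite doubleS !big_nat_recr //= IHk -mulrA; congr (_ * (_ * (1 - _))).
by rewrite -exprM mulnS mul2n.
Qed.

Lemma sqr_trunc : (q ^+ 2) ^+ K = 0.
Proof. by rewrite -exprM mulnC exprM qK expr0n. Qed.

Lemma qfact_trunc m : (K <= m)%N -> qfact (q ^+ 2) m = euler_prod (q ^+ 2).
Proof.
move=> le_Km; rewrite /qfact big_add1 /= (prod_trunc _ le_Km) // => i le_Ki.
by rewrite (expr_trunc sqr_trunc) ?subr0 // ltnW.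
Qed.

Lemma sum_dist n (F : nat -> A) :
  \sum_(0 <= k < n.*2.+1) F (k - n + (n - k))%N = F 0 + 2 * \sum_(1 <= i < n.+1) F i.
Proof.
rewrite (big_cat_nat (n := n)) //=; last by lia.
rewrite big_nat_rev /= (@big_ltn _ _ _ n); last by lia.
rewrite subnn [in RHS]big_add1 /= addrCA mulrDl mul1r; congr (_ + (_ + _)).
  by apply: eq_big_nat => i lt_in; congr F; lia.
have -> : (n.*2.+1 = n + n.+1)%N by lia.
rewrite -{1}[n.+1]add0n big_addn addnK; apply: eq_big_nat => i _; congr F; lia.
Qed.

(** This is [finite_gauss] at n = 2K, evaluated at q. Terms with |k - n| >= K vanish; otherwise k
    and 4K - k both exceed K, so all q-factorials equal E = [euler_prod (q ^+ 2)], and cancelling E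
    shows that the q-binomial times E is 1. *)
Lemma gauss_theta : odd_euler_prod q ^+ 2 * euler_prod (q ^+ 2) = theta q.
Proof.
have cq : commr_rmorph (intr : int -> A) q by move=> z; apply: mulrC.
pose ev : {rmorphism {poly int} -> A} := horner_morph cq.
have evX i : ev 'X^i = q ^+ i by rewrite rmorphXn /= horner_morphX.
have := congr1 ev (finite_gauss int K.*2).
rewrite rmorphXn rmorph_prod rmorph_sum /=.
rewrite (eq_big_nat _ _ (F2 := fun i => 1 - q ^+ i.*2.+1)); last first.
  by move=> i _; rewrite rmorphB rmorph1 evX.
rewrite (prod_trunc (F := fun i => 1 - q ^+ i.*2.+1)); last 2 first.
- by move=> i le_Ki; rewrite (expr_trunc qK) ?subr0 //; lia.
- by rewrite -addnn leq_addr.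
rewrite -/(odd_euler_prod q) => ->; rewrite big_distrl /=.
pose F d := (-1) ^+ d * q ^+ (d ^ 2).
transitivity (\sum_(0 <= k < K.*2.*2.+1) F (k - K.*2 + (K.*2 - k))%N).
  apply: eq_big_nat => k lt_k; rewrite !rmorphM rmorphXn rmorphN1 evX rmorph_qbin /= evX.
  rewrite /F; set d := (k - K.*2 + _)%N.
  have -> : (-1) ^+ (K.*2 + k) = (-1) ^+ d :> A.
    rewrite -signr_odd -[RHS]signr_odd; congr (_ ^+ _); congr nat_of_bool.
    by rewrite /d; lia.
  have [le_Kd | lt_dK] := leqP K d.
    by rewrite (expr_trunc qK (i := (d ^ 2)%N)) ?mulr0 ?mul0r //; nia.
  rewrite -[RHS]mulr1 -[LHS]mulrA; congr (_ * _).
  apply: (lregM (euler_prod_lreg sqr_trunc) (euler_prod_lreg sqr_trunc)).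
  rewrite mulr1 -{1}(qfact_trunc (m := k)); last by lia.
  rewrite -{1}(qfact_trunc (m := K.*2.*2 - k)); last by lia.
  rewrite -{2}(qfact_trunc (m := K.*2.*2)); last by lia.
  by rewrite -(qbin_qfact _ (m := K.*2.*2) (k := k)); [ring|lia].
rewrite sum_dist /theta /F expr0 mul1r; congr (1 + 2 * _).
have [K0 | K_gt0] := posnP K.
  by move: qK; rewrite K0 expr0 => /eqP; rewrite oner_eq0.
rewrite (big_cat_nat (n := K)) //=; last by lia.
rewrite /theta_half [X in _ + X]big_nat_cond [X in _ + X]big1 ?addr0 // => i.
by rewrite andbT => /andP[le_Ki _]; rewrite /F (expr_trunc qK) ?mulr0 //; nia.
Qed.

End Truncated.
End Gauss.

(** * The generating function *)

Section Counting.

Variables (s n : nat).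

Definition support_part (m : {ffun cpart s n -> 'I_n.+1}) : {set cpart s n} :=
  [set x | 0 < m x].

Lemma abar_sum :
  abar s n = \sum_(m : {ffun cpart s n -> 'I_n.+1}
                   | [forall x, (0 < m x) ==> admissible x] &&
                     (\sum_(x : cpart s n) x.1 * m x == n)) 2 ^ #|support_part m|.
Proof.
rewrite /abar cardsE -sum1_card.
rewrite -(pair_big_dep predT (fun m o => is_overpartition m o) (fun _ _ => 1)) /=.
rewrite [RHS]big_mkcond; apply: eq_bigr => m _.
rewrite sum1dep_card /is_overpartition; case: ifP => [/andP[-> ->] | cond].
  rewrite -card_powerset -[RHS]cardsE; apply: eq_card => o; rewrite !inE andbT.
  by apply/'forall_implyP/subsetP => o_m x /o_m; rewrite inE.
by apply: eq_card0 => o; rewrite inE andbCA cond andbF.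
Qed.

Local Open Scope ring_scope.

Variable R : comNzRingType.

(** Truncated series of (1 + q^j)/(1 - q^j) for j = [x.1]; the 2 counts the overlining choice. A
    pair that is not admissible never occurs and gets the factor 1. *)
Definition part_factor (A : comNzRingType) (q : A) (x : cpart s n) : A :=
  1 + (if admissible x then 2 * \sum_(1 <= k < n.+1) (q ^+ x.1) ^+ k else 0).

Lemma coef_abar : (\prod_x part_factor ('X : {poly R}) x)`_n = (abar s n)%:R.
Proof.
pose c (x : cpart s n) (k : nat) : R :=
  if k == 0 then 1 else if admissible x then 2 else 0.
rewrite (eq_bigr (fun x => \sum_(k < n.+1) c x k *: 'X^(x.1 * k))); last first.
  move=> x _; rewrite -(big_mkord predT (fun k => c x k *: 'X^(x.1 * k))) big_ltn //.
  rewrite /c eqxx scale1r muln0 expr0 /part_factor; congr (1 + _).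
  rewrite big_add1; case: ifP => adm.
    rewrite big_distrr big_add1; apply: eq_bigr => k _.
    by rewrite /= exprM scaler_nat mulr_natl.
  by rewrite big1 // => k _; rewrite /= scale0r.
rewrite bigA_distr_bigA /= coef_sum abar_sum natr_sum [RHS]big_mkcond /=.
apply: eq_bigr => m _; rewrite scaler_prod prodrXr coefZ coefXn [n == _]eq_sym.
have [_ | _] := eqVneq _ n; last by rewrite andbF mulr0.
rewrite mulr1 andbT; case: ifP => [/forallP adm | /negbT].
  rewrite natrX -prodr_const [RHS]big_mkcond /=; apply: eq_bigr => x _.
  by rewrite /c inE lt0n; have := adm x; rewrite lt0n; case: eqP => //= _ ->.
rewrite negb_forall => /existsP[x]; rewrite negb_imply => /andP[mx Nadm].
by rewrite (bigD1 x) //= /c eqn0Ngt mx (negPf Nadm) mul0r.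
Qed.

End Counting.

Section GeneratingFunction.
Local Open Scope ring_scope.

Lemma part_factor_geometric s n (A : comNzRingType) (q : A) (x : cpart s n) :
  q ^+ n.+1 = 0 -> admissible x ->
  part_factor q x * (1 - q ^+ x.1) = 1 + q ^+ x.1.
Proof.
move=> qn adm; rewrite /part_factor adm; set y := q ^+ _.
have yn : y ^+ n.+1 = 0.
  by rewrite -exprM mulnC exprM qn expr0n; case/andP: adm => /lt0n_neq0/negPf->.
have := subrX1 y n.+1; rewrite yn sub0r -(big_mkord predT (fun i => y ^+ i)).
rewrite big_ltn // expr0; set S := \sum_(1 <= i < _) _ => e.
have -> : (1 + 2 * S) * (1 - y) = 1 + y - 2 * (1 + (y - 1) * (1 + S)) by ring.
by rewrite -e; ring.
Qed.

(** Odd sizes come in s + 1 colours, even sizes in one. Sizes above n contribute 1, so the range can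
    be extended to 2(n+1) and split by parity. *)
Lemma prod_admissible s n (A : comNzRingType) (h : nat -> A) :
  (forall j, (n < j)%N -> h j = 1) ->
  \prod_(x : cpart s.+1 n | admissible x) h x.1 =
  (\prod_(0 <= i < n.+1) h i.*2.+1) ^+ s.+1 * \prod_(0 <= i < n.+1) h i.+1.*2.
Proof.
move=> h1; pose g j := if odd j then h j ^+ s.+1 else h j.
transitivity (\prod_(0 <= j < n) g j.+1).
  rewrite -(pair_big_dep predT (fun (j : 'I_n.+1) (c : 'I_s.+1) => admissible (j, c))
              (fun j c => h j)) /=.
  transitivity (\prod_(j < n.+1) (if j == 0 :> nat then 1 else g j)).
    apply: eq_bigr => j _; rewrite /admissible /= /g lt0n.
    have [_ | _] /= := eqVneq (j : nat) 0%N; first by rewrite big_pred0.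
    have [_ | _] := boolP (odd j); first by rewrite prodr_const card_ord.
    by rewrite (big_pred1 ord0).
  rewrite -(big_mkord xpredT (fun j => if j == 0 :> nat then 1 else g j)).
  by rewrite [LHS]big_ltn // mul1r big_add1.
transitivity (\prod_(0 <= j < n.+1.*2) g j.+1).
  symmetry; apply: prod_trunc; last by rewrite -addnn; lia.
  by move=> i le_ni; rewrite /g h1 ?expr1n ?if_same.
rewrite -prodrXl -big_split /=; elim: n.+1 => [|k IHk]; first by rewrite !big_geq.
by rewrite doubleS !big_nat_recr //= IHk -mulrA /g /= odd_double /=.
Qed.

(** Let O, Op be the products of 1 - q^j, 1 + q^j over odd j, and E, Ep those over even j. Then W
    O^(s+1) E = Op^(s+1) Ep, and the claim follows after multiplying by the cancellable E, from Op O
    = O(q^2), Ep E = E(q^2) and E = O(q^2) E(q^2). *)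
Lemma abar_theta s n (A : comNzRingType) (q : A) : q ^+ n.+1 = 0 ->
  (\prod_(x : cpart s.+1 n) part_factor q x) * theta n.+1 q ^+ s.+1 =
  theta n.+1 (q ^+ 2) ^+ s.
Proof.
move=> qn; have q2n := sqr_trunc qn; have q4n := sqr_trunc q2n.
set W := \prod_x _.
pose Op := \prod_(0 <= i < n.+1) (1 + q ^+ i.*2.+1).
pose Ep := \prod_(0 <= i < n.+1) (1 + q ^+ i.+1.*2).
have WE : W * (odd_euler_prod n.+1 q ^+ s.+1 * euler_prod n.+1 (q ^+ 2)) =
          Op ^+ s.+1 * Ep.
  have -> : euler_prod n.+1 (q ^+ 2) = \prod_(0 <= i < n.+1) (1 - q ^+ i.+1.*2).
    by apply: eq_bigr => i _; rewrite -exprM mul2n.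
  rewrite -(prod_admissible _ (h := fun j => 1 - q ^+ j)); last first.
    by move=> j lt_nj; rewrite (expr_trunc qn) ?subr0.
  rewrite -(prod_admissible _ (h := fun j => 1 + q ^+ j)); last first.
    by move=> j lt_nj; rewrite (expr_trunc qn) ?addr0.
  have -> : W = \prod_(x : cpart s.+1 n | admissible x) part_factor q x.
    rewrite [RHS]big_mkcond; apply: eq_bigr => x _ /=.
    by case: ifP => // Nadm; rewrite /part_factor Nadm addr0.
  rewrite -big_split /=; apply: eq_bigr => x adm.
  exact: part_factor_geometric.
have OE : Op * odd_euler_prod n.+1 q = odd_euler_prod n.+1 (q ^+ 2).
  rewrite -big_split; apply: eq_bigr => i _ /=.
  by rewrite -exprM mulnC exprM; ring.
have EE : Ep * euler_prod n.+1 (q ^+ 2) = euler_prod n.+1 (q ^+ 2 ^+ 2).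
  rewrite -big_split; apply: eq_bigr => i _ /=.
  by rewrite -mul2n exprM (exprAC (q ^+ 2) 2); ring.
have split2 := euler_prod_split q2n.
rewrite -(gauss_theta qn) -(gauss_theta q2n).
move: WE OE EE split2; set O := odd_euler_prod _ q; set E := euler_prod _ (q ^+ 2).
set O2 := odd_euler_prod _ _; set E4 := euler_prod _ _ => WE OE EE split2.
apply: (euler_prod_lreg q2n); rewrite -/E.
transitivity ((W * (O ^+ s.+1 * E)) * (O ^+ s.+1 * E) * E ^+ s).
  by rewrite exprMn -exprM mulnC exprM ![E ^+ s.+1]exprS; ring.
rewrite WE; transitivity ((Op * O) ^+ s.+1 * (Ep * E) * E ^+ s).
  by rewrite exprMn; ring.
rewrite OE EE split2 exprS !exprMn; ring.
Qed.

End GeneratingFunction.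

(** * Reduction modulo 16 *)

Section Mod16.
Local Open Scope ring_scope.

Lemma in_qpoly_coef (R : comNzRingType) n (p r : {poly R}) i :
  in_qpoly 'X^(n.+1) p = in_qpoly 'X^(n.+1) r -> (i <= n)%N -> p`_i = r`_i.
Proof.
move=> /(congr1 val) /=; rewrite mk_monic_Xn /= => eq_mod le_in.
have coef_mod (u : {poly R}) : u`_i = (Pdiv.CommonRing.rmodp u 'X^(n.+1))`_i.
  rewrite {1}(Pdiv.RingMonic.rdivp_eq (monicXn R n.+1) u) coefD coefMXn ltnS le_in.
  by rewrite add0r.
by rewrite coef_mod eq_mod -coef_mod.
Qed.

Lemma rmorph_theta_half (A B : comNzRingType) (f : {rmorphism A -> B}) K q :
  f (theta_half K q) = theta_half K (f q).
Proof.
rewrite rmorph_sum; apply: eq_bigr => i _.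
by rewrite rmorphM !rmorphXn rmorphN1.
Qed.

Lemma rmorph_theta (A B : comNzRingType) (f : {rmorphism A -> B}) K q :
  f (theta K q) = theta K (f q).
Proof. by rewrite rmorphD rmorphM rmorph1 rmorph_nat rmorph_theta_half. Qed.

(** * Powers of theta when 16 = 0 *)

Section Char16.

Variable A : comNzRingType.
Hypothesis A16 : 16 = 0 :> A.
Implicit Types S T U : A.

Lemma expr_1add2 T b : (1 + 2 * T) ^+ b =
  1 + b%:R * (2 * T) + 'C(b, 2)%:R * (4 * T ^+ 2) + 'C(b, 3)%:R * (8 * T ^+ 3).
Proof.
elim: b => [|b IHb]; first by rewrite expr0 !bin_small //; ring.
rewrite exprS IHb !binS bin1 -[b.+1]addn1 !natrD.
transitivity (1 + (b%:R + 1) * (2 * T) + ('C(b, 2)%:R + b%:R) * (4 * T ^+ 2) +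
  ('C(b, 3)%:R + 'C(b, 2)%:R) * (8 * T ^+ 3) + 16 * ('C(b, 3)%:R * T ^+ 4)).
  by ring.
by rewrite A16; ring.
Qed.

(** Terms with four or more factors S, T carry 16. The rules 8 S^2 = 8 T and 8 T^2 = 8 U shorten the
    cubic terms, and ab = 2e turns 4ab ST into 8e ST. *)
Lemma theta_expand S T U a b e :
  8 * S ^+ 2 = 8 * T -> 8 * T ^+ 2 = 8 * U -> (a * b = e.*2)%N ->
  (1 + 2 * T) ^+ b * (1 + 2 * S) ^+ a =
  1 + (2 * a)%:R * S + (2 * b)%:R * T
  + (4 * 'C(a, 2))%:R * (S * S) + (4 * 'C(b, 2))%:R * (T * T)
  + (8 * b * 'C(a, 2))%:R * U + (8 * 'C(b, 2) * a)%:R * (S * U)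
  + (e + 'C(a, 3))%:R * (8 * (S * T)) + 'C(b, 3)%:R * (8 * (T * U)).
Proof.
move=> SST TTU ab; rewrite !expr_1add2.
have {}ab : a%:R * b%:R = 2 * e%:R :> A by rewrite -natrM ab -mul2n natrM.
move: ab; rewrite !natrD !natrM; move: (a%:R) (b%:R) (e%:R) ('C(a, 2)%:R) ('C(a, 3)%:R)
  ('C(b, 2)%:R) ('C(b, 3)%:R) => {}a {}b {}e a2 a3 b2 b3 ab.
transitivity (1 + 2 * a * S + 2 * b * T + 4 * a2 * (S * S) + 4 * b2 * (T * T)
  + b * a2 * T * (8 * S ^+ 2) + b2 * a * S * (8 * T ^+ 2)
  + 4 * (a * b) * (S * T) + a3 * S * (8 * S ^+ 2) + b3 * T * (8 * T ^+ 2)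
  + 16 * (b * a3 * T * S ^+ 3 + b2 * a2 * T ^+ 2 * S ^+ 2
    + 2 * b2 * a3 * T ^+ 2 * S ^+ 3
    + b3 * a * T ^+ 3 * S + 2 * b3 * a2 * T ^+ 3 * S ^+ 2
    + 4 * b3 * a3 * T ^+ 3 * S ^+ 3)).
  by ring.
rewrite A16 ab SST TTU.
transitivity (1 + 2 * a * S + 2 * b * T + 4 * a2 * (S * S) + 4 * b2 * (T * T)
  + b * a2 * (8 * T ^+ 2) + b2 * a * S * (8 * U)
  + 8 * e * (S * T) + a3 * S * (8 * T) + b3 * T * (8 * U)); first by ring.
by rewrite TTU; ring.
Qed.

(** The cross terms of the square carry 16. *)
Lemma frobenius8 (F : nat -> A) m n :
  8 * (\sum_(m <= i < n) F i) ^+ 2 = 8 * \sum_(m <= i < n) F i ^+ 2.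
Proof.
rewrite unlock /=; elim: (index_iota m n) => [|i r IHr] /=; first by ring.
rewrite mulrDr -IHr; set x := reducebig _ _ _.
have -> : 8 * (F i + x) ^+ 2 = 8 * F i ^+ 2 + 8 * x ^+ 2 + 16 * (F i * x) by ring.
by rewrite A16; ring.
Qed.

Lemma mul8_sign (k : nat) : 8 * (-1) ^+ k = 8 :> A.
Proof.
rewrite -signr_odd; case: (odd k); rewrite ?expr0 ?mulr1 // expr1.
have -> : 8 * -1 = 8 - 16 :> A by ring.
by rewrite A16 subr0.
Qed.

Lemma sqr_theta_half K (q : A) :
  8 * theta_half K q ^+ 2 = 8 * theta_half K (q ^+ 2).
Proof.
rewrite frobenius8 ![8 * \sum_(_ <= _ < _) _]big_distrr /=; apply: eq_bigr => i _.
by rewrite exprMn sqrr_sign mul1r [in RHS]mulrA mul8_sign exprAC.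
Qed.

(** The coefficients 16, 112 and 448 are multiples of 16. Hence the seventh power of theta is its
    inverse, which clears the denominator of the generating function. *)
Lemma theta_expr8 K (q : A) : theta K q ^+ 8 = 1.
Proof.
rewrite /theta expr_1add2 (_ : 'C(8, 3) = 56%N) // (_ : 'C(8, 2) = 28%N) //.
set S := theta_half _ _; have -> : 1 + 8%:R * (2 * S) + 28%:R * (4 * S ^+ 2) +
  56%:R * (8 * S ^+ 3) = 1 + 16 * (S + 7 * S ^+ 2 + 28 * S ^+ 3) by ring.
by rewrite A16; ring.
Qed.

End Char16.

Local Notation R := 'Z_16.
Local Notation PR := {poly R}.

Lemma Z16 : 16 = 0 :> R. Proof. by apply/val_inj. Qed.
Lemma P16 : 16 = 0 :> PR. Proof. by rewrite -polyC_natr Z16. Qed.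

(** This is [abar_theta] multiplied by the 7(s+1)-th power of theta. That identity needs a nilpotent
    argument, which X becomes only in a quotient, hence the morphism f. *)
Lemma rmorph_part_factors (A B : comNzRingType) (f : {rmorphism A -> B}) q s n :
  16 = 0 :> B -> f q ^+ n.+1 = 0 ->
  f (\prod_(x : cpart s.+1 n) part_factor q x) =
  f (theta n.+1 (q ^+ 2) ^+ s * theta n.+1 q ^+ (7 * s.+1)).
Proof.
move=> B16 fq0; rewrite rmorphM !rmorphXn !rmorph_theta rmorphXn -(abar_theta s fq0).
have e8 : (s.+1 + 7 * s.+1 = 8 * s.+1)%N by lia.
rewrite -mulrA -exprD e8 exprM (theta_expr8 B16) expr1n mulr1.
rewrite rmorph_prod; apply: eq_bigr => x _.
rewrite rmorphD rmorph1; congr (1 + _); case: ifP => _; last by rewrite rmorph0.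
rewrite rmorphM rmorph_nat rmorph_sum; congr (2 * _); apply: eq_bigr => k _.
by rewrite !rmorphXn.
Qed.

(** The identity is read modulo X^(N+1), which still determines the coefficient at N. *)
Lemma abar_coef s N : (abar s.+1 N)%:R =
  (theta N.+1 'X^2 ^+ s * theta N.+1 'X ^+ (7 * s.+1) : PR)`_N.
Proof.
rewrite -coef_abar; apply: (@in_qpoly_coef _ N) => //.
pose f : {rmorphism PR -> {poly %/ 'X^(N.+1)}} := in_qpoly 'X^(N.+1).
apply: (rmorph_part_factors (f := f)); first by rewrite -(rmorph_nat f) P16 rmorph0.
rewrite -rmorphXn; apply/val_inj => /=.
by rewrite mk_monic_Xn Pdiv.RingMonic.rmodpp ?monicXn.
Qed.

Lemma coef_signXn m k N : ((-1) ^+ m * 'X^k : PR)`_N = (-1) ^+ m * (k == N)%:R.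
Proof.
rewrite -signr_odd -[in RHS]signr_odd [k == N]eq_sym.
by case: (odd m); rewrite ?expr0 ?expr1 ?mulN1r ?mul1r ?coefN coefXn.
Qed.

Lemma coef_theta_half_Xn K a N : (theta_half K 'X^a : PR)`_N =
  \sum_(1 <= i < K) (-1) ^+ i * (a * i ^ 2 == N)%N%:R.
Proof.
rewrite coef_sum; apply: eq_bigr => i _.
by rewrite -exprM coef_signXn.
Qed.

Lemma coef_theta_half_mul K a b N : (theta_half K 'X^a * theta_half K 'X^b : PR)`_N =
  \sum_(1 <= i < K) \sum_(1 <= j < K)
     (-1) ^+ (i + j) * (a * i ^ 2 + b * j ^ 2 == N)%N%:R.
Proof.
rewrite big_distrl coef_sum; apply: eq_bigr => i _.
rewrite big_distrr coef_sum; apply: eq_bigr => j _ /=.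
rewrite mulrACA -exprD -!exprM -exprD.
exact: coef_signXn.
Qed.

Lemma coef_theta_half_eq0 K a N :
  (forall i, a * i ^ 2 <> N)%N -> (theta_half K 'X^a : PR)`_N = 0.
Proof.
move=> h; rewrite coef_theta_half_Xn big1 // => i _.
by have /eqP/negPf -> := h i; rewrite mulr0.
Qed.

Lemma coef_theta_half_mul_eq0 K a b N :
  (forall i j, a * i ^ 2 + b * j ^ 2 <> N)%N ->
  (theta_half K 'X^a * theta_half K 'X^b : PR)`_N = 0.
Proof.
move=> h; rewrite coef_theta_half_mul big1 // => i _; rewrite big1 // => j _.
by have /eqP/negPf -> := h i j; rewrite mulr0.
Qed.

(** As 8 = -8, the signs drop out and representations are counted. The scaling a serves both ST (a =
    1) and TU (a = 2). *)
Lemma coef_theta_half_mul8 B a M : (0 < a)%N ->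
  8 * (theta_half B.+1 'X^a * theta_half B.+1 'X^(2 * a) : PR)`_(a * M) =
  8 * (size (reps12 B M))%:R.
Proof.
move=> a_gt0; rewrite coef_theta_half_mul /reps12 -sum1_size big_filter.
rewrite [in RHS]big_mkcond.
rewrite big_allpairs_dep /= natr_sum !big_distrr /index_iota subn1.
apply: eq_bigr => i _; rewrite natr_sum !big_distrr; apply: eq_bigr => j _ /=.
have -> : (a * i ^ 2 + 2 * a * j ^ 2 = a * (i ^ 2 + 2 * j ^ 2))%N by lia.
by rewrite mulrA (mul8_sign Z16) eqn_pmul2l //.
Qed.

End Mod16.

(** * The coefficient at 2M for M = 3 mod 4 *)

Lemma reps12_double M :
  size (reps12 (2 * M) (2 * M)) = size (reps12 (2 * M) M).
Proof.
symmetry; have le_M : M <= 2 * M by lia.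
apply: (@size_bij _ _ (fun t => (2 * t.2, t.1))); rewrite ?reps12_uniq //.
  by case=> [a b] [c d] _ _ [? ->]; congr (_, _); lia.
case=> x y; rewrite mem_reps12 //; apply/and3P/mapP.
  (* Since 2M is even, x = 2k, and halving gives M = y^2 + 2k^2. *)
  case=> x0 y0 /eqP e; have [k ek] : exists k, x = 2 * k.
    exists x./2; rewrite mul2n halfK.
    have : ~~ odd (x ^ 2 + 2 * y ^ 2) by rewrite e mul2n odd_double.
    by rewrite oddD oddX oddM addbF => /negPf/= ->; rewrite subn0.
  exists (y, k); last by rewrite ek.
  by rewrite mem_reps12 // y0; apply/andP; split; [lia|apply/eqP; lia].
case=> -[a b]; rewrite mem_reps12 // => /and3P[a0 b0 /eqP e] [-> ->] /=.
by split=> //; [lia|apply/eqP; lia].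
Qed.

Lemma sum_sqr_mod8 i j N : N %% 8 = 6 -> i * i + j * j <> N.
Proof. by move=> N8 e; have := sqr_mod8 i; have := sqr_mod8 j; lia. Qed.

Lemma abar_double_mod16 s M : 0 < s -> M %% 4 = 3 ->
  ~~ odd (size (reps12 (2 * M) M)) ->
  abar s (2 * M) = 0 %[mod 16].
Proof.
case: s => // s _ M4 even_M; have := even_M; rewrite -reps12_double => even_2M.
set N := 2 * M.
have N8 : N %% 8 = 6 by rewrite /N; lia.
have ss := @sum_sqr_mod8 _ _ N N8.
have even8 k : ~~ odd k -> (8 * k%:R = 0 :> 'Z_16)%R.
  move=> /negPf even_k; rewrite -[k]odd_double_half even_k add0n -mul2n natrM.
  by rewrite mulrA -natrM Z16 mul0r.
suff /(congr1 val) : ((abar s.+1 N)%:R = 0 :> 'Z_16)%R by rewrite /= val_Zp_nat.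
rewrite abar_coef.
(* Here a = 7(s+1) and b = s, so ab = 7s(s+1) = 2e. *)
rewrite (theta_expand (U := theta_half N.+1 ('X^2 ^+ 2)%R) (e := 7 * 'C(s.+1, 2)) P16);
  [|exact: sqr_theta_half P16 _ _ ..|]; last first.
  by have := double_bin2 s.+1; lia.
have XX : ('X^2 ^+ 2 = 'X^(2 * 2) :> {poly 'Z_16})%R by rewrite -exprM.
have coef_natM k (p : {poly 'Z_16}) i : ((k%:R * p)`_i = k%:R * p`_i)%R.
  by rewrite mulr_natl coefMn mulr_natl.
rewrite XX !coefD !coef_natM.
have S0 : ((theta_half N.+1 'X : {poly 'Z_16})`_N = 0)%R.
  by apply: (@coef_theta_half_eq0 _ 1) => i; have := sqr_mod8 i; lia.
have SS0 : ((theta_half N.+1 'X * theta_half N.+1 'X : {poly 'Z_16})`_N = 0)%R.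
  by apply: (@coef_theta_half_mul_eq0 _ 1 1) => i j; have := ss i j; lia.
have SU0 : ((theta_half N.+1 'X * theta_half N.+1 'X^(2 * 2) : {poly 'Z_16})`_N = 0)%R.
  by apply: (@coef_theta_half_mul_eq0 _ 1) => i j; have := ss i (2 * j); lia.
have T0 : ((theta_half N.+1 'X^2 : {poly 'Z_16})`_N = 0)%R.
  by apply: coef_theta_half_eq0 => i; have := sqr_mod8 i; lia.
have U0 : ((theta_half N.+1 'X^(2 * 2) : {poly 'Z_16})`_N = 0)%R.
  by apply: coef_theta_half_eq0 => i; have := sqr_mod8 i; lia.
(* An equality 2i^2 + 2j^2 = 2M would make M a sum of two squares, impossible modulo 4. *)
have TT0 : ((theta_half N.+1 'X^2 * theta_half N.+1 'X^2 : {poly 'Z_16})`_N = 0)%R.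
  apply: coef_theta_half_mul_eq0 => i j.
  by have := sqr_mod8 i; have := sqr_mod8 j; lia.
(* The two remaining coefficients are 8 times the even counts for 2M and for M. *)
have ST0 : (8 * (theta_half N.+1 'X * theta_half N.+1 'X^2 : {poly 'Z_16})`_N = 0)%R.
  have := @coef_theta_half_mul8 N 1 N isT.
  by rewrite !mul1n !muln1 even8.
have TU0 : (8 * (theta_half N.+1 'X^2 *
                  theta_half N.+1 'X^(2 * 2) : {poly 'Z_16})`_N = 0)%R.
  by rewrite coef_theta_half_mul8 // even8.
rewrite S0 SS0 SU0 T0 U0 TT0 ST0 TU0 coef1 eqn0Ngt (_ : 0 < N); last by lia.
by rewrite !mulr0 !addr0.
Qed.

Lemma abar_vanishing p s n k :
  prime p -> p = 1 %[mod 4] -> 0 < s -> ~~ (p %| 4 * n + 3) ->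
  abar s (2 * (p ^ (4 * k + 1) * (4 * n + 3))) = 0 %[mod 16].
Proof.
move=> p_pr p4 s_gt0 pNm; set v := 4 * k + 1; set M := p ^ v * _.
have M4 : M %% 4 = 3.
  by rewrite -modnMm -modnXm p4 modnXm exp1n modnMmr mul1n; lia.
have le_M : M <= 2 * M by rewrite leq_pmull.
(* If M = 3 mod 8, [even_below_sqrt] applies: 4k + 1 is odd and 4n + 3 is never a square. If M = 7
   mod 8, there are no representations at all. *)
have [M8 | M8] : M %% 8 = 3 \/ M %% 8 = 7 by lia.
  have even_M : ~~ odd (size (reps12 (2 * M) M)).
    rewrite odd_reps12 // even_below_sqrt //; first by rewrite /v; lia.
    by move=> u e; have := sqr_mod8 u; lia.
  exact: abar_double_mod16.
have no_reps x y : x ^ 2 + 2 * y ^ 2 <> M.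
  by move=> e; have := sqr_mod8 x; have := sqr_mod8 y; lia.
apply: abar_double_mod16 => //; case e: (reps12 _ _) => [|[x y] r] //.
by have := mem_head (x, y) r; rewrite -e mem_reps12 // => /and3P[_ _ /eqP/no_reps].
Qed.

Theorem theorem1p11 (p s : nat) :
  prime p -> p = 1 %[mod 4] -> 0 < s ->
  abar s (6 * p) = 0 %[mod 2] ->
  forall n k : nat, ~~ (p %| 4 * n + 3) ->
    abar s (8 * p ^ (4 * k + 1) * n + 6 * p ^ (4 * k + 1)) = 0 %[mod 16].
Proof.
move=> p_pr p4 s_gt0 _ n k pNm; rewrite -(abar_vanishing k p_pr p4 s_gt0 pNm).
by congr (abar _ _ %% _); lia.
Qed.
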